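(* Let $F\in C_c(\mathbb{R})$. Then $$\lim_{N\to\infty}\frac1N\sum_{n=1}^N F\Big(\frac{\Omega(n)-\log\log N}{\sqrt{\log\log N}}\Big)\lambda(n)=0.$$
   Context: For $n\in\mathbb{N}=\{1,2,\dots\}$, $\Omega(n)$ denotes the number of prime factors of $n$ counted with multiplicity (so $\Omega(1)=0$), and $\lambda(n)=(-1)^{\Omega(n)}$ is the Liouville function. $C_c(\mathbb{R})$ is the set of continuous compactly supported functions on $\mathbb{R}$. The averages are considered for $N\ge 3$, so that $\log\log N>0$. *)

(* Defs.v *)
From mathcomp Require Import all_boot all_order all_algebra.
From mathcomp Require Import all_classical all_reals all_analysis.

Set Implicit Arguments.
Unset Strict Implicit.
Unset Printing Implicit Defensive.

Import Order.TTheory GRing.Theory Num.Theory.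
Import numFieldNormedType.Exports.

Local Open Scope classical_set_scope.
Local Open Scope ring_scope.

Definition bigomega (n : nat) : nat := (\sum_(p <- primes n) logn p n)%N.

Definition liouville (n : nat) : int := (-1) ^+ bigomega n.

Definition compactly_supported (R : realType) (F : R -> R) : Prop :=
  compact (closure [set x | F x != 0]).

Definition loglog (R : realType) (N : nat) : R := ln (ln N%:R).

(* Main.v *)
Require Import Defs.
From mathcomp Require Import all_boot all_order all_algebra.
From mathcomp Require Import all_classical all_reals all_analysis.
From mathcomp Require Import zify ring lra.

(** Write [a_N n] for the [n]-th summand.  As [N] grows, [1 / sqrt (loglog N)]
tends to [0], so uniform continuity of [F] gives [a_N (p n) = - a_N n + o(1)],
uniformly in the prime [p] and in [n >= 1].  This approximate sign flip and a
uniform bound on [a_N] already force the mean of [a_N] over [1..N] to tend to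
[0] ([sign_flipping_mean]).  The argument is in the spirit of Richter's
elementary proof of the prime number theorem.

Let [T d = (d / N) * sum_(n <= N / d) a_N n], so that [T 1] is the mean to be
estimated.  Two properties of [T] are used.

- Flipping.  By the Turan-Kubilius inequality, for a finite set [B] of primes
  with large reciprocal sum [L], the number [T d] is within [O(1 / sqrt L) + o(1)]
  of the average of [- T (d p)] over [p] in [B] with weights [1 / p].  Taking for
  [B] the primes at which [- T (d p)] falls short of [T d] by [eps] shows that
  these exceptional primes have a reciprocal sum bounded in terms of [eps] alone
  ([light_flip_failures]).

- Slow variation.  [T d] and [T e] are close when [d / e] is close to [1]
  ([dilated_mean_slowly_varying]).

Suppose that [T 1] is far from [0], say positive.  Flipping once along a prime
[p], and twice along primes [q] and [r], gives [- T p >= T 1 - eps] and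
[T (q r) >= T 1 - 2 eps].  Chebyshev's lower bound for primes in [(8^j, 8^(j+1)]]
([size_window]) gives room to choose non-exceptional [p], [q], [r] with
[p / (q r)] between [1/64] and [64] ([light_complement_triple]).  The two indices
are then moved together: multiply the larger one by a prime [p1] and the smaller
one by a slightly larger prime [q1], both non-exceptional.  Both values change
sign, hence remain opposite, while the ratio of the indices shrinks by [q1 / p1].
If [q1 / p1] lies in [[1 + eta, 1 + c]], a number of steps depending only on [c]
brings the ratio below [1 + c], and slow variation contradicts the opposite
values ([flipping_slow_small]).

Pairs with such ratios exist among non-exceptional primes because primes cannot
be concentrated on very short intervals: the product of the primes in
[(n, n + k]] divides ['C(n + k, k)], which is small when [k / n] is small
([primes_short_interval], [close_pair]). *)

Set Implicit Arguments.
Unset Strict Implicit.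
Unset Printing Implicit Defensive.

Import Order.TTheory GRing.Theory Num.Theory.
Import numFieldNormedType.Exports.

(** * Chebyshev's lower bound between consecutive powers of 8 *)

Lemma prod_primes_dvd (P : seq nat) (m : nat) :
  uniq P -> all prime P -> all (dvdn^~ m) P -> \prod_(p <- P) p %| m.
Proof.
elim: P => [|p P IH] /=; first by rewrite big_nil dvd1n.
move=> /andP[pP uP] /andP[pr prP] /andP[dp dP].
rewrite big_cons Gauss_dvd ?dp ?IH // prime_coprime // Euclid_dvd_prod //.
rewrite big_has; apply/hasPn => q qP.
rewrite dvdn_prime2 // ?(allP prP) //; apply: contraNneq pP => ->; exact: qP.
Qed.

(** A prime in [(n, n + k]] divides [(n + k)!] but, as [k <= n], it divides neither
[n!] nor [k!]. *)
Lemma prod_primes_le_bin (P : seq nat) (n k : nat) :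
  uniq P -> all prime P -> {in P, forall p, n < p <= n + k} -> k <= n ->
  \prod_(p <- P) p <= 'C(n + k, k).
Proof.
move=> uP prP inP kn; apply: dvdn_leq; first by rewrite bin_gt0 leq_addl.
apply: prod_primes_dvd => //; apply/allP => p pP.
have pr := allP prP _ pP; have /andP[np pnk] := inP _ pP.
have fact_ndvd m : m <= n -> ~~ (p %| m`!).
  move=> mn; rewrite fact_prod Euclid_dvd_prod // big_has; apply/hasPn => i.
  rewrite mem_index_iota => /andP[i0 im]; rewrite gtnNdvd //; lia.
have : p %| (n + k)`! by rewrite dvdn_fact // prime_gt0.
rewrite -(@bin_fact (n + k) k) ?leq_addl // addnK !Euclid_dvdM //.
by rewrite (negbTE (fact_ndvd _ kn)) (negbTE (fact_ndvd _ (leqnn n))) !orbF.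
Qed.

Lemma bin_le_exp2 (n k : nat) : 'C(n, k) <= 2 ^ n.
Proof.
elim: n k => [|n IH] [|k] //; first by rewrite bin0 expn_gt0.
by rewrite binS expnS mul2n -addnn leq_add.
Qed.

Lemma exp2_le_central_bin (n : nat) : 2 ^ n <= 'C(n + n, n).
Proof.
elim: n => // n IH; rewrite addnS addSn binS.
have -> : 'C((n + n).+1, n.+1) = 'C((n + n).+1, n).
  by rewrite -bin_sub; [congr 'C(_, _); lia | lia].
rewrite addnn expnS mul2n leq_double (leq_trans IH) // leq_bin2l //; lia.
Qed.

(** The primes in [(2^i, 2^(i+1)]] all divide the central binomial coefficient
['C(2^(i+1), 2^i)], so passing from [i] to [i + 1] costs a factor at most
[2 ^ 2^(i+1)]. *)
Lemma primorial_le (k : nat) :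
  \prod_(1 <= p < (2 ^ k).+1 | prime p) p <= 2 ^ (2 * 2 ^ k).
Proof.
elim: k => [|k IH]; first by rewrite big_mkcond big_nat1.
rewrite (@big_cat_nat _ _ _ (2 ^ k).+1) //=; last by rewrite ltnS leq_exp2l.
have -> : 2 ^ k.+1 = 2 ^ k + 2 ^ k by rewrite expnS mul2n addnn.
rewrite mulnDr expnD leq_mul // -big_filter mul2n -addnn.
apply: leq_trans (bin_le_exp2 _ (2 ^ k)).
apply: prod_primes_le_bin => //.
- by rewrite filter_uniq // iota_uniq.
- exact: filter_all.
- by move=> p; rewrite mem_filter mem_index_iota => /andP[_]; lia.
Qed.

(** Legendre's formula: the power [p ^ k] contributes [2n %/ p^k - 2 (n %/ p^k)] to
the exponent of [p], which is [0] or [1], and [0] as soon as [p ^ k > 2n]. *)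
Lemma pfactor_central_bin (p n : nat) : prime p -> 0 < n ->
  p ^ logn p 'C(n + n, n) <= n + n.
Proof.
move=> pr n0; have p1 := prime_gt1 pr.
set t := trunc_log p (n + n).
suff le_t : logn p 'C(n + n, n) <= t.
  apply: leq_trans (trunc_logP p1 _); last by rewrite addn_gt0 n0.
  by rewrite leq_pexp2l // ltnW.
have := @bin_fact (n + n) n (leq_addl _ _); rewrite addnK => /(congr1 (logn p)).
rewrite !lognM ?muln_gt0 ?fact_gt0 ?bin_gt0 ?leq_addl // !logn_fact //.
have ext : \sum_(1 <= k < n.+1) n %/ p ^ k = \sum_(1 <= k < (n + n).+1) n %/ p ^ k.
  rewrite [RHS](@big_cat_nat _ _ _ n.+1) //=; last by rewrite ltnS leq_addl.
  rewrite [X in _ = _ + X](_ : _ = 0) ?addn0 //.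
  rewrite big_nat_cond big1 // => k /andP[/andP[nk _] _].
  by rewrite divn_small // (ltn_trans nk) // ltn_expl.
rewrite ext => eqv.
have tn : t <= n + n.
  rewrite ltnW // (leq_trans (ltn_expl t p1)) // trunc_logP //.
  by rewrite addn_gt0 n0.
have : \sum_(1 <= k < (n + n).+1) (n + n) %/ p ^ k <=
    t + \sum_(1 <= k < (n + n).+1) (n %/ p ^ k + n %/ p ^ k).
  rewrite (@big_cat_nat _ _ _ t.+1) //=.
  rewrite [in X in _ <= X](@big_cat_nat _ _ _ t.+1) //= addnA.
  rewrite leq_add //; last first.
    rewrite big_nat_cond big1 // => k /andP[/andP[tk _] _].
    rewrite divn_small // (leq_trans (trunc_log_ltn (n + n) p1)) //.
    by rewrite leq_pexp2l // ltnW.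
  rewrite [X in _ <= X + _](_ : t = \sum_(1 <= k < t.+1) 1); last first.
    by rewrite sum_nat_const_nat muln1 subn1.
  rewrite -big_split /= leq_sum // => k _.
  have p0 : 0 < p ^ k by rewrite expn_gt0 (ltnW p1).
  by rewrite divnD // addnC leq_add2r leq_b1.
by rewrite big_split /=; lia.
Qed.

(** Consecutive windows have ratio [8] because the proof of [size_window] compares
[2 ^ (4 x) <= 'C(8 x, 4 x)] with the bound [4 ^ x] on the product of the primes up
to [x]; the ratio has to leave a margin between the two. *)
Definition window (j : nat) : seq nat :=
  [seq p <- index_iota (8 ^ j).+1 (8 ^ j.+1).+1 | prime p].

Lemma mem_window j p :
  (p \in window j) = [&& prime p, 8 ^ j < p & p <= 8 ^ j.+1].
Proof. by rewrite mem_filter mem_index_iota ltnS. Qed.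

Lemma uniq_window j : uniq (window j).
Proof. by rewrite filter_uniq // iota_uniq. Qed.

Lemma twelve_mul_le_exp2 j : 7 <= j -> 12 * j.+1 <= 2 ^ j.
Proof.
elim: j => // j IH; rewrite leq_eqVlt => /orP[/eqP<-//|/IH].
by rewrite expnS; lia.
Qed.

Lemma prod_cond_const (a b c : nat) (P : pred nat) :
  \prod_(a <= p < b) (if P p then c else 1) = c ^ count P (index_iota a b).
Proof.
elim: (index_iota a b) => [|x s IH]; first by rewrite big_nil.
by rewrite big_cons IH /= expnD; case: (P x); rewrite ?expn1.
Qed.

(** With [x = 8 ^ j], factor ['C(8 x, 4 x)].  Primes up to [r = 4 ^ (j+1)] are few and
contribute at most [8 x] each; those in [(r, x]] have exponent at most [1], since
[r ^ 2 >= 8 x], and contribute at most [4 ^ x] together; those of the window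
contribute at most [8 x] each, and have to make up for the rest of [2 ^ (4 x)]. *)
Lemma size_window j : 7 <= j -> 8 ^ j <= 3 * j.+1 * size (window j).
Proof.
move=> j7; set x := 8 ^ j; set n := 4 * x; set b := 'C(n + n, n).
have x0 : 0 < x by rewrite expn_gt0.
have x8' : n + n = 8 ^ j.+1 by rewrite /n /x expnS; lia.
have x8 : n + n = 2 ^ (3 * j.+1) by rewrite x8' (expnM 2 3).
(* r ^ 2 >= 8 x, while r * log2 (8 x) = o(x). *)
set r := 4 * 4 ^ j.
have r2 : n + n <= r * r.
  rewrite /n /r /x.
  have -> : 4 * 4 ^ j * (4 * 4 ^ j) = 16 * 16 ^ j by rewrite mulnACA -expnMn.
  suff : 8 ^ j <= 16 ^ j by lia.
  by rewrite leq_exp2r //; lia.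
have n0 : 0 < n by lia.
have rx : 3 * j.+1 * r <= x.
  rewrite /r /x (_ : 8 = 2 * 4) // expnMn.
  have := leq_mul (twelve_mul_le_exp2 j7) (leqnn (4 ^ j)); lia.
have b0 : 0 < b by rewrite bin_gt0 leq_addl.
have bE : b <= \prod_(1 <= p < (n + n).+1)
    ((if p <= r then n + n else 1) * (if (p <= x) && prime p then p else 1)
     * (if (x < p) && prime p then n + n else 1)).
  rewrite -{1}(partnT b0) (widen_partn _ (bin_le_exp2 _ _)).
  rewrite (@big_cat_nat _ _ _ (n + n).+1) //=; last by rewrite ltnS ltnW // ltn_expl.
  rewrite [X in _ * X <= _](_ : _ = 1) ?muln1; last first.
    rewrite big_nat_cond big1 // => p /andP[/andP[np _] _].
    case: (boolP (prime p)) => [pr|npr]; last by rewrite lognE (negbTE npr).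
    have pv := pfactor_central_bin pr n0; rewrite -/b in pv.
    case v : (logn p b) => [|v'] //; rewrite v expnS in pv.
    have p0 : 0 < p ^ v' by rewrite expn_gt0 prime_gt0.
    nia.
  rewrite (eq_bigl xpredT) // big_ltn // [logn 0 _]lognE /= mul1n !big_seq leq_prod // => p.
  rewrite mem_index_iota => /andP[p0 pn].
  case: (boolP (prime p)) => [pr|npr]; last first.
    by rewrite lognE (negbTE npr) !andbF /= !muln1; case: ifP => //; lia.
  have pv := pfactor_central_bin pr n0; rewrite -/b in pv.
  rewrite !andbT; case: (leqP p r) => pr'.
    apply: leq_trans pv _; case: leqP => _; nia.
  have : logn p b <= 1.
    rewrite leqNgt; apply/negP => v2.
    have : p ^ 2 <= n + n by apply: leq_trans pv; rewrite leq_exp2l // prime_gt1.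
    nia.
  rewrite leq_eqVlt ltnS leqn0 => /orP[|] /eqP v; rewrite v in pv *.
    by case: leqP => px; rewrite ?mul1n ?muln1 // (leq_trans pv).
  by rewrite muln_gt0 mul1n; do 2 case: ifP; lia.
rewrite !big_split /= in bE.
rewrite !prod_cond_const in bE.
have r_le : count (fun p => p <= r) (index_iota 1 (n + n).+1) <= r.
  rewrite -size_filter -[leqRHS](size_iota 1); apply: uniq_leq_size.
    by rewrite filter_uniq ?iota_uniq.
  move=> p; rewrite mem_filter mem_index_iota mem_iota; lia.
have prim : \prod_(1 <= p < (n + n).+1) (if (p <= x) && prime p then p else 1) =
    \prod_(1 <= p < x.+1 | prime p) p.
  rewrite (@big_cat_nat _ _ _ x.+1) //=; last by lia.
  rewrite [X in _ * X = _]big_nat_cond [X in _ * X = _]big1 ?muln1; last first.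
    by move=> p /andP[/andP[xp _] _]; rewrite leqNgt xp.
  rewrite [RHS]big_mkcond; apply: eq_big_nat => p /andP[_].
  by rewrite ltnS => ->.
have win :
    count (fun p => (x < p) && prime p) (index_iota 1 (n + n).+1) = size (window j).
  rewrite -size_filter; apply/perm_size/uniq_perm.
  - by rewrite filter_uniq ?iota_uniq.
  - exact: uniq_window.
  move=> p; rewrite mem_window mem_filter mem_index_iota -x8' /x.
  by case: (prime p); lia.
have primo := primorial_le (3 * j); rewrite expnM -/x in primo.
have : 2 ^ n <= (n + n) ^ r * 2 ^ (2 * x) * (n + n) ^ size (window j).
  apply: leq_trans (exp2_le_central_bin n) _; apply: leq_trans bE _.
  rewrite prim win; apply: leq_mul => //; apply: leq_mul => //.
  rewrite leq_pexp2l //; lia.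
rewrite !x8 -!expnM -!expnD leq_exp2l //.
rewrite /n; lia.
Qed.

Local Open Scope classical_set_scope.
Local Open Scope ring_scope.

(** * Primes in short intervals, and pairs of nearby primes *)

Lemma bin_mul_exp_le (n k m : nat) : ('C(n + k, k) * m ^ n <= m.+1 ^ (n + k))%N.
Proof.
rewrite -addn1 expnDn (bigD1 (inord k)) //= inordK ?ltnS ?leq_addl //.
by rewrite addnK exp1n muln1 leq_addr.
Qed.

Lemma expR1_le8 (R : realType) : expR 1 <= 8 :> R.
Proof.
have h : 1 / 2 <= expR (- (1 / 2)) :> R.
  by apply: le_trans (expR_ge1Dx _); lra.
have e0 : 0 < expR (1 / 2) :> R by exact: expR_gt0.
have h2 : expR (1 / 2) <= 2 :> R.
  rewrite expRN in h; rewrite -[leLHS]invrK -[leRHS]invrK.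
  by rewrite lef_pV2 ?posrE ?invr_gt0 //; lra.
have -> : 1 = 1 / 2 + 1 / 2 :> R by lra.
rewrite expRD; nra.
Qed.

(** The product of the primes in [P] divides ['C(n + k, k)], and
['C(n + k, k) <= (1 + 1/m) ^ n * (m + 1) ^ k <= expR (n / m + m * k)].
The parameter [m] is free: if [k <= n / m ^ 2], the proportion of primes is
[O(1 / (m j))], which is small compared with the [1 / j] of [size_window] once
[m] is large. *)
Lemma primes_short_interval (R : realType) (P : seq nat) (j n k m : nat) :
  uniq P -> all prime P -> {in P, forall p, n < p <= n + k}%N -> (k <= n)%N ->
  (8 ^ j <= n)%N -> (0 < m)%N ->
  (j * size P)%:R <= n%:R / m%:R + (m * k)%:R :> R.
Proof.
move=> uP prP inP kn jn m0; rewrite -ler_expR expRD.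
have m0R : 0 < m%:R :> R by rewrite ltr0n.
have lower : expR (j * size P)%:R <= ('C(n + k, k))%:R :> R.
  apply: (@le_trans _ _ ((8 ^ j) ^ size P)%:R).
    rewrite -expnM natrX -[(j * size P)%:R]mul1r.
    by rewrite expRM_natr lerXn2r ?nnegrE ?expR_ge0 ?expR1_le8.
  rewrite ler_nat; apply: leq_trans (prod_primes_le_bin uP prP inP kn).
  have : all (fun p => 8 ^ j <= p)%N P.
    by apply/allP => p /inP /andP[np _]; lia.
  elim: (P) => [|p s IH] /=; first by rewrite big_nil.
  by move=> /andP[jp /IH]; rewrite big_cons expnS; exact: leq_mul.
apply: le_trans lower _.
have := bin_mul_exp_le n k m; rewrite -(ler_nat R) natrM !natrX -ler_pdivlMr ?exprn_gt0 //.
move=> /le_trans; apply.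
rewrite exprD mulrAC; apply: ler_pM; rewrite ?divr_ge0 ?exprn_ge0 //.
  rewrite -expr_div_n [n%:R / _]mulrC expRM_natr lerXn2r ?nnegrE ?expR_ge0 ?divr_ge0 //.
  by rewrite -natr1 mulrDl divff ?gt_eqF // mul1r expR_ge1Dx.
rewrite natrM expRM_natr lerXn2r ?nnegrE ?expR_ge0 //.
by rewrite -natr1 addrC expR_ge1Dx.
Qed.

Lemma exists_nat_ge (R : realType) (A : R) : exists t : nat, A <= t%:R.
Proof.
exists (Num.bound `|A|); apply: le_trans (ler_norm _) (ltW (archi_boundP _)).
exact: normr_ge0.
Qed.

Lemma exists_exp_ge (R : realType) (c A : R) : 0 < c ->
  exists K, A <= (1 + c) ^+ K.
Proof.
move=> c0; have [K HK] := exists_nat_ge (A / c).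
exists K; rewrite ler_pdivrMr // in HK; apply: le_trans HK _.
have : 1 + K%:R * c <= (1 + c) ^+ K.
  elim: K => [|K IH]; first by rewrite mul0r addr0 expr0.
  rewrite exprS -natr1; have : 0 <= K%:R :> R by [].
  nra.
lra.
Qed.

Lemma exp_ratio_large (R : realType) (A : R) :
  exists j0, forall j, (j0 <= j)%N -> A * j.+1%:R <= (8 ^ j)%:R.
Proof.
have [t At] := exists_nat_ge A.
exists t => j tj; apply: (@le_trans _ _ ((2 ^ j * 2 ^ j)%:R)); last first.
  by rewrite ler_nat -expnMn; case: j tj => // j _; rewrite leq_exp2r.
rewrite natrM; apply: le_trans (_ : (t%:R * j.+1%:R <= _)).
  by rewrite ler_wpM2r.
rewrite -!natrM ler_nat leq_mul //; last exact: ltn_expl.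
by apply: (leq_trans tj); rewrite ltnW // ltn_expl.
Qed.

(** If all ratios of elements of [P] are below [1 + 1 / m ^ 2], then [P] lies in a short
interval that starts at its least element. *)
Lemma cluster_size (R : realType) (P : seq nat) (j m : nat) :
  uniq P -> {subset P <= window j} -> (0 < m)%N -> (0 < j)%N ->
  {in P &, forall p q, q * m ^ 2 < p * (m ^ 2).+1}%N ->
  (size P)%:R <= 1 + 16 * (8 ^ j)%:R / (m%:R * j%:R) :> R.
Proof.
move=> uP PW m0 j0 close.
have m0R : 0 < m%:R :> R by rewrite ltr0n.
have j0R : 0 < j%:R :> R by rewrite ltr0n.
case: (posnP (size P)) => [->|]; first by rewrite addr_ge0 // divr_ge0 ?mulr_ge0.
case EP : P => [|p1 P1] // _; rewrite -EP.
have exP : exists p, p \in P by exists p1; rewrite EP mem_head.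
case: (ex_minnP exP) => p0 p0P p0min.
have /PW := p0P; rewrite mem_window => /and3P[pr0 jp0 p0j].
pose k := (p0 %/ m ^ 2)%N.
have m20 : (0 < m ^ 2)%N by rewrite expn_gt0 m0.
have := @primes_short_interval R (rem p0 P) j p0 k m.
rewrite rem_uniq // => /(_ isT).
have -> : all prime (rem p0 P).
  by apply/allP => p /mem_rem /PW; rewrite mem_window => /and3P[].
have inP : {in rem p0 P, forall p : nat, (p0 < p <= p0 + k)%N}.
  move=> p; rewrite mem_rem_uniq // inE => /andP[pp0 pP].
  have p0p := p0min _ pP; have clo := close _ _ p0P pP.
  rewrite ltn_neqAle eq_sym pp0 p0p /= -leq_subLR leq_divRL // mulnBl.
  lia.
move=> /(_ isT inP (leq_div _ _) (ltnW jp0) m0).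
rewrite size_rem // => H.
have sz : (size P)%:R = 1 + (size P).-1%:R :> R by rewrite EP /= -natr1 addrC.
rewrite sz lerD2l ler_pdivlMr ?mulr_gt0 //.
have kb : (m * k)%:R <= p0%:R / m%:R :> R.
  rewrite ler_pdivlMr // -natrM ler_nat mulnC mulnA mulnn mulnC.
  exact: leq_trunc_div.
have p0b : p0%:R <= 8 * (8 ^ j)%:R :> R by rewrite -natrM ler_nat -expnS.
rewrite [m%:R * _]mulrC mulrA [_ * j%:R]mulrC -ler_pdivlMr // -(natrM _ j).
apply: (le_trans H).
have -> : 16 * (8 ^ j)%:R / m%:R =
    (8 * (8 ^ j)%:R / m%:R) + (8 * (8 ^ j)%:R / m%:R) :> R.
  by field; rewrite gt_eqF.
have : p0%:R / m%:R <= 8 * (8 ^ j)%:R / m%:R :> R by rewrite ler_pM2r ?invr_gt0.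
lra.
Qed.

(** Cut [(X, X (1 + c) ^ K]] into [K] blocks of ratio [1 + c].  Two elements of the same
block have a ratio at most [1 + c], hence below [1 + 1 / m ^ 2] by the gap
hypothesis, so that each block meets [P] in a cluster. *)
Lemma sparse_ratios_size (R : realType) (c : R) (j m K : nat) (P : seq nat) (X : R) :
  uniq P -> {subset P <= window j} -> (0 < m)%N -> (0 < j)%N -> 0 < c ->
  {in P, forall p, X < p%:R <= X * (1 + c) ^+ K} ->
  {in P &, forall p q, (p * (m ^ 2).+1 <= q * m ^ 2)%N -> (1 + c) * p%:R < q%:R} ->
  (size P)%:R <= K%:R * (1 + 16 * (8 ^ j)%:R / (m%:R * j%:R)) :> R.
Proof.
move=> uP PW m0 j0 c0; elim: K X P uP PW => [|K IH] X P uP PW PX gap.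
  rewrite mul0r; case: P PX {uP PW gap} => // p P /(_ _ (mem_head _ _)).
  by rewrite expr0 mulr1 => /andP[/lt_le_trans H /H]; rewrite ltxx.
(* Split off the lowest block and apply the induction to the others. *)
pose lo (p : nat) := p%:R <= X * (1 + c).
rewrite -(count_predC lo) natrD -!size_filter -natr1 mulrDl mul1r addrC.
apply: lerD.
  apply: (IH (X * (1 + c))).
  - exact: filter_uniq.
  - by move=> p; rewrite mem_filter => /andP[_ /PW].
  - move=> p; rewrite mem_filter /= -ltNge => /andP[-> /PX /andP[_]].
    by rewrite exprS mulrA.
  - by move=> p q; rewrite !mem_filter => /andP[_ pP] /andP[_ qP]; exact: gap.
apply: cluster_size => //.
- exact: filter_uniq.
- by move=> p; rewrite mem_filter => /andP[_ /PW].
move=> p q; rewrite !mem_filter => /andP[_ pP] /andP[lq qP].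
rewrite ltnNge; apply/negP => /(gap _ _ pP qP).
have /andP[Xp _] := PX _ pP.
rewrite /lo in lq => H; have := lt_le_trans H lq.
rewrite mulrC ltr_pM2r ?(lt_trans Xp) //; last by lra.
by rewrite ltNge ltW.
Qed.

(** A fixed proportion of the primes of a window does not fit in boundedly many
clusters of very small ratio, and so contains two primes whose ratio is at most
[1 + c] but bounded away from [1]. *)
Lemma close_pair (R : realType) (c D : R) : 0 < c -> 0 < D ->
  exists2 eta : R, 0 < eta & exists j0, forall j (P : seq nat), (j0 <= j)%N ->
    uniq P -> {subset P <= window j} -> D * (8 ^ j)%:R / j.+1%:R <= (size P)%:R ->
    exists2 p, p \in P & exists2 q, q \in P &
      (1 + eta) * p%:R <= q%:R <= (1 + c) * p%:R.
Proof.
move=> c0 D0.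
have [K HK] := exists_exp_ge 8 c0.
(* K blocks of at most 1 + 16 * 8^j / (m j) primes: m makes the second terms add up
   to at most a quarter of D * 8^j / (j+1), and j0 does so for the K units. *)
have [m Hm] : exists m : nat, 128 * K%:R / D <= m.+1%:R.
  have [m Hm] := exists_nat_ge (128 * K%:R / D).
  by exists m; rewrite (le_trans Hm) // ler_nat.
exists ((m.+1 ^ 2)%:R^-1); first by rewrite invr_gt0 ltr0n expn_gt0.
have [j0 Hj] := exp_ratio_large (4 * K%:R / D).
exists j0.+1 => j P jj uP PW sz.
apply: contrapT => none.
have : (size P)%:R <= K%:R * (1 + 16 * (8 ^ j)%:R / (m.+1%:R * j%:R)) :> R.
  apply: (@sparse_ratios_size R c j m.+1 K P (8 ^ j)%:R) => //; first by lia.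
  - move=> p /PW; rewrite mem_window => /and3P[_ jp pj]; rewrite ltr_nat jp /=.
    apply: (@le_trans _ _ ((8 ^ j)%:R * 8)); last by rewrite ler_pM2l // ltr0n expn_gt0.
    by rewrite -natrM ler_nat mulnC -expnS.
  - move=> p q pP qP H; rewrite ltNge; apply/negP => H'; apply: none.
    exists p => //; exists q => //; rewrite H' andbT.
    have M0 : 0 < (m.+1 ^ 2)%:R :> R by rewrite ltr0n expn_gt0.
    rewrite -(ler_pM2r M0) mulrAC mulrDl mul1r mulVf ?gt_eqF //.
    by rewrite natr1 -!natrM ler_nat mulnC.
apply/negP; rewrite -ltNge; apply: lt_le_trans sz.
have j1 : (0 < j)%N by lia.
have HJ := Hj j (ltnW jj).
set y : R := (8 ^ j)%:R in HJ *.
have y0 : 0 < y by rewrite ltr0n expn_gt0.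
have jR : 0 < j%:R :> R by rewrite ltr0n.
have mR : 0 < m.+1%:R :> R by rewrite ltr0n.
rewrite ler_pdivrMr // in Hm.
rewrite mulrAC ler_pdivrMr // in HJ.
rewrite mulrDr mulr1 ltr_pdivlMr // mulrDl.
have H1 : K%:R * j.+1%:R <= D * y / 4 by lra.
have H2 : K%:R * (16 * y / (m.+1%:R * j%:R)) * j.+1%:R <= D * y / 4.
  have -> : K%:R * (16 * y / (m.+1%:R * j%:R)) * j.+1%:R =
      (K%:R * 16 * y * (j.+1%:R / j%:R)) / m.+1%:R by field; rewrite !gt_eqF.
  rewrite ler_pdivrMr //.
  have jj2 : j.+1%:R / j%:R <= 2 :> R.
    by rewrite ler_pdivrMr // -natrM ler_nat; lia.
  have ? : 0 <= j.+1%:R / j%:R :> R by rewrite divr_ge0.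
  have ? : 0 <= K%:R :> R by [].
  apply: (@le_trans _ _ (K%:R * 16 * y * 2)).
    by rewrite ler_wpM2l // mulr_ge0 ?mulr_ge0 // ltW.
  nra.
apply: (le_lt_trans (lerD H1 H2)); move: (mulr_gt0 D0 y0); clear; set u := D * y; lra.
Qed.

(** * Exceptional primes and the comparison of opposite values *)

Definition mass (R : realType) (B : seq nat) : R := \sum_(p <- B) p%:R^-1.

(** The exceptional sets of the comparison argument.  Only primes up to [Q] are
tested, so that a single [N] can be large enough for all of them. *)
Definition light (R : realType) (Q : nat) (L : R) (E : pred nat) : Prop :=
  forall B : seq nat, uniq B -> all prime B ->
    {in B, forall p, (p <= Q)%N && E p} -> mass R B <= L.

Lemma massC (R : realType) (E : pred nat) (B : seq nat) :
  mass R B = mass R (seq.filter E B) + mass R (seq.filter (predC E) B).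
Proof. by rewrite /mass !big_filter (bigID E). Qed.

Lemma mass_ge0 (R : realType) (B : seq nat) : 0 <= mass R B.
Proof. by rewrite /mass sumr_ge0. Qed.

Lemma light_predU (R : realType) (Q : nat) (L1 L2 : R) (E1 E2 : pred nat) :
  light Q L1 E1 -> light Q L2 E2 -> light Q (L1 + L2) (predU E1 E2).
Proof.
move=> l1 l2 B uB prB BE; rewrite (massC R E1) lerD //.
  apply: l1; [exact: filter_uniq | |].
    by apply/allP => p; rewrite mem_filter => /andP[_ /(allP prB)].
  by move=> p; rewrite mem_filter => /andP[-> /BE /andP[->]].
apply: l2; [exact: filter_uniq | |].
  by apply/allP => p; rewrite mem_filter => /andP[_ /(allP prB)].
by move=> p; rewrite mem_filter /= => /andP[/negbTE nE1 /BE]; rewrite /= nE1.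
Qed.

Lemma light_ge0 (R : realType) (Q : nat) (L : R) (E : pred nat) : light Q L E -> 0 <= L.
Proof. by move=> /(_ [::] isT isT); rewrite /mass big_nil; apply. Qed.

(** The windows are disjoint.  The shift [h] serves to compare window [j] for one set
with window [j + h] for another, over the same range of [j]. *)
Lemma light_windows (R : realType) (Q : nat) (L : R) (E : pred nat) (h a b : nat) :
  light Q L E -> (8 ^ (b + h) <= Q)%N ->
  \sum_(a <= j < b) mass R (seq.filter E (window (j + h))) <= L.
Proof.
move=> lE bQ; case: (leqP a b) => [ab|ba]; last first.
  by rewrite big_geq ?(light_ge0 lE) // ltnW.
pose B n := [seq p <- index_iota (8 ^ (a + h)).+1 (8 ^ (n + h)).+1 | prime p && E p].
suff -> : \sum_(a <= j < b) mass R (seq.filter E (window (j + h))) = mass R (B b).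
  apply: lE.
  - by rewrite filter_uniq // iota_uniq.
  - by apply/allP => p; rewrite mem_filter => /andP[/andP[]].
  - move=> p; rewrite mem_filter mem_index_iota => /andP[/andP[_ ->] /andP[_]].
    by rewrite ltnS andbT => /leq_trans; apply.
have B0 n : (n <= a)%N -> mass R (B n) = 0.
  by move=> na; rewrite /mass big_filter big_geq // ltnS leq_exp2l // leq_add2r.
elim: b ab {bQ} => [a0|b IH]; first by rewrite big_geq // B0.
rewrite leq_eqVlt => /orP[/eqP eab|]; first by rewrite big_geq ?B0 // eab.
rewrite ltnS => ab; rewrite big_nat_recr //= IH // /mass /B /window !big_filter.
rewrite big_filter_cond.
rewrite [RHS](@big_cat_nat _ _ _ (8 ^ (b + h)).+1) //=.
- by rewrite ltnS leq_exp2l // leq_add2r.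
- by rewrite ltnS leq_exp2l.

Qed.

Lemma mass_window (R : realType) (j : nat) : (7 <= j)%N ->
  (24 * j.+1)%:R^-1 <= mass R (window j).
Proof.
move=> j7; apply: (@le_trans _ _ ((size (window j))%:R / (8 ^ j.+1)%:R)).
  rewrite ler_pdivlMr ?ltr0n ?expn_gt0 // ler_pdivrMl ?ltr0n // -natrM ler_nat.
  have := size_window j7; rewrite expnS; lia.
rewrite /mass -sum1_size natr_sum mulr_suml big_seq [leRHS]big_seq.
apply: ler_sum => p; rewrite mem_window => /and3P[pr _ pj].
rewrite mul1r lef_pV2 ?posrE ?ltr0n ?expn_gt0 ?(prime_gt0 pr) //.
by rewrite ler_nat.
Qed.

Lemma mass_le_size (R : realType) (j : nat) (P : seq nat) : {subset P <= window j} ->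
  mass R P * (8 ^ j)%:R <= (size P)%:R.
Proof.
move=> PW; rewrite /mass mulr_suml -sum1_size natr_sum big_seq [leRHS]big_seq.
apply: ler_sum => p /PW; rewrite mem_window => /and3P[pr pj _].
by rewrite ler_pdivrMl ?ltr0n ?prime_gt0 // mulr1 ler_nat ltnW.
Qed.

Lemma harmonic_unbounded (R : realType) (L : R) (a j0 : nat) :
  exists2 J, (j0 <= J)%N & L < \sum_(j0 <= j < J) (24 * (j + a).+1)%:R^-1.
Proof.
have [t Ht] : exists t : nat, L * 48 < t%:R.
  by have [t Ht] := exists_nat_ge (L * 48); exists t.+1; rewrite (le_lt_trans Ht) // ltr_nat.
suff [J jJ HJ] : exists2 J, (j0 <= J)%N &
    t%:R / 48 <= \sum_(j0 <= j < J) (24 * (j + a).+1)%:R^-1 :> R.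
  by exists J => //; apply: lt_le_trans HJ; rewrite ltr_pdivlMr.
elim: t {Ht} => [|t [J jJ IH]]; first by exists j0 => //; rewrite mul0r big_geq.
(* J + a + 1 terms, each at least 1 / (48 (J + a + 1)). *)
exists (J + (J + a).+1)%N; first by lia.
rewrite (@big_cat_nat _ _ _ J) //=; last by lia.
rewrite -natr1 mulrDl lerD //.
apply: (@le_trans _ _ (\sum_(J <= j < J + (J + a).+1) (48 * (J + a).+1)%:R^-1)).
  rewrite sumr_const_nat addKn mul1r -[leRHS]mulr_natl natrM invfM mulrCA divff ?pnatr_eq0 //.
  by rewrite mulr1.
rewrite !big_nat; apply: ler_sum => j /andP[Jj jJ'].
by rewrite lef_pV2 ?posrE ?ltr0n // ler_nat; lia.
Qed.

(** The windows weigh at least [1 / (24 (j + 1))], a divergent series, so a light set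
must leave at least half of that weight uncovered in some window; [close_pair]
applies to the uncovered primes. *)
Lemma light_complement_pair (R : realType) (c : R) : 0 < c ->
  exists2 eta : R, 0 < eta & forall L : R, exists Q0, forall Q (E : pred nat),
    (Q0 <= Q)%N -> light Q L E ->
    exists p q, [/\ prime p, prime q, (p <= Q)%N, (q <= Q)%N &
      [/\ ~~ E p, ~~ E q & (1 + eta) * p%:R <= q%:R <= (1 + c) * p%:R]].
Proof.
move=> c0; have [eta eta0 [j0 Hj]] := @close_pair R c 48^-1 c0 ltac:(lra).
exists eta => // L; pose j1 := maxn j0 7.
have [J jJ HJ] := harmonic_unbounded (L * 2) 0 j1.
exists (8 ^ J)%N => Q E QJ lE.
have [j jr mj] : exists2 j, (j1 <= j < J)%N &
    mass R (seq.filter E (window j)) < (24 * j.+1)%:R^-1 / 2.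
  apply: contrapT => none; have := @light_windows R Q L E 0 j1 J lE; rewrite addn0 => /(_ QJ).
  apply/negP; rewrite -ltNge -(ltr_pM2r (_ : 0 < 2)) // (lt_le_trans HJ) // mulr_suml !big_nat.
  apply: ler_sum => j jr; rewrite !addn0 -ler_pdivrMr // leNgt; apply/negP => H.
  by apply: none; exists j.
have [j1j jJ'] := andP jr.
set G := seq.filter (predC E) (window j).
have GW : {subset G <= window j} by move=> p; rewrite mem_filter => /andP[].
have sG : 48^-1 * (8 ^ j)%:R / j.+1%:R <= (size G)%:R :> R.
  apply: le_trans (mass_le_size R GW).
  rewrite mulrAC ler_pM2r ?ltr0n ?expn_gt0 //.
  have := @mass_window R j ltac:(lia); rewrite (massC R E) -/G.
  have -> : 48^-1 / j.+1%:R = (24 * j.+1)%:R^-1 / 2 :> R by rewrite natrM; field.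
  move: mj; set u := mass R G; set v := mass R _; set w := _^-1 => mj H.
  by clear -mj H; lra.
have [p] := Hj j G ltac:(lia) (filter_uniq _ (uniq_window j)) GW sG.
have wQ p' : p' \in window j -> (p' <= Q)%N.
  rewrite mem_window => /and3P[_ _ /leq_trans]; apply; apply: leq_trans QJ.
  by rewrite leq_exp2l.
rewrite mem_filter => /andP[Ep pW] [q]; rewrite mem_filter => /andP[Eq qW] pq.
exists p, q; rewrite !wQ //; split => //.
  by move: pW; rewrite mem_window => /and3P[].
by move: qW; rewrite mem_window => /and3P[].
Qed.

Lemma window_of (q : nat) : (1 < q)%N -> exists h, (8 ^ h < q <= 8 ^ h.+1)%N.
Proof.
move=> q1; have ex : exists h, (q <= 8 ^ h)%N by exists q; rewrite ltnW // ltn_expl.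
case: (ex_minnP ex) => -[|h] qh hmin; first by rewrite expn0 in qh; lia.
by exists h; rewrite qh andbT ltnNge; apply/negP => /hmin; rewrite ltnn.
Qed.

Lemma window_sub (j Q : nat) : (8 ^ j.+1 <= Q)%N -> {in window j, forall p, (p <= Q)%N}.
Proof. by move=> jQ p; rewrite mem_window => /and3P[_ _ /leq_trans]; apply. Qed.

(** If [q] lies in window [h] and [r] in window [j], then [q * r] is within a factor [64]
of every element of window [j + h].  Were there no admissible [j], for each [j]
either window [j] or window [j + h] would be covered by one of two light sets,
which the divergence of [1 / (24 (j + 1))] excludes.  The bound [Q0] is uniform in
[q] because [q] is chosen first, among the primes up to [8 ^ J1]. *)
Lemma light_complement_triple (R : realType) (L : R) :
  exists Q0, forall Q (E : pred nat) (E' : nat -> pred nat),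
    (Q0 <= Q)%N -> light Q L E ->
    (forall q, prime q -> (q <= Q)%N -> ~~ E q -> light Q L (E' q)) ->
  exists p q r, [/\ [/\ prime p, prime q & prime r],
      [/\ (p <= Q)%N, (q <= Q)%N & (r <= Q)%N],
      [/\ ~~ E p, ~~ E q & ~~ E' q r], (q * r < 64 * p)%N & (p < 64 * (q * r))%N].
Proof.
have [J1 J71 H1] := harmonic_unbounded L 0 7.
have [J2 J72 H2] := harmonic_unbounded (L + L) J1 7.
exists (8 ^ (J2 + J1))%N => Q E E' QJ lE lE'.
have [q prq /andP[qJ nEq]] : exists2 q, prime q & (q <= 8 ^ J1)%N && ~~ E q.
  apply: contrapT => none.
  have := @light_windows R Q L E 0 7 J1 lE; rewrite addn0.
  have QJ1 : (8 ^ J1 <= Q)%N by apply: leq_trans QJ; rewrite leq_exp2l // leq_addl.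
  move=> /(_ QJ1); apply/negP; rewrite -ltNge (lt_le_trans H1) // !big_nat.
  apply: ler_sum => j /andP[j7 jJ]; rewrite !addn0.
  suff /all_filterP -> : all E (window j) by exact: mass_window.
  apply/allP => q qW; apply/negPn/negP => nE; apply: none; exists q.
    by move: qW; rewrite mem_window => /and3P[].
  rewrite nE andbT; apply: (window_sub _ qW); by rewrite leq_exp2l.
have qQ : (q <= Q)%N by apply: leq_trans qJ (leq_trans _ QJ); rewrite leq_exp2l // leq_addl.
have [h /andP[hq qh]] := window_of (prime_gt1 prq).
have hJ : (h < J1)%N by rewrite -(@ltn_exp2l 8) // (leq_trans hq).
have l2 := lE' _ prq qQ nEq.
have [j jr [p [r [pW rW nEp nEr]]]] : exists2 j, (7 <= j < J2)%N & exists p r,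
    [/\ p \in window (j + h), r \in window j, ~~ E p & ~~ E' q r].
  apply: contrapT => none.
  have S1 := @light_windows R Q L E h 7 J2 lE.
  have S2 := @light_windows R Q L (E' q) 0 7 J2 l2.
  have := lerD (S1 _) (S2 _); rewrite -big_split /=.
  have Q1 : (8 ^ (J2 + h) <= Q)%N by apply: leq_trans QJ; rewrite leq_exp2l // leq_add2l ltnW.
  have Q2 : (8 ^ (J2 + 0) <= Q)%N by apply: leq_trans QJ; rewrite leq_exp2l // leq_add2l.
  move=> /(_ Q1 Q2); apply/negP; rewrite -ltNge (lt_le_trans H2) // !big_nat.
  apply: ler_sum => j jr; have /andP[j7 jJ] := jr; rewrite addn0.
  have le24 x y : (x <= y)%N -> (24 * y.+1)%:R^-1 <= (24 * x.+1)%:R^-1 :> R.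
    by move=> xy; rewrite lef_pV2 ?posrE ?ltr0n // ler_nat; lia.
  have [aE|/allPn[p pW nE]] := boolP (all E (window (j + h))).
    move/all_filterP: aE => ->; apply: ler_wpDr; first exact: mass_ge0.
    apply: le_trans (mass_window _ _); last by lia.
    by apply: le24; rewrite leq_add2l ltnW.
  have [aE'|/allPn[r rW nE']] := boolP (all (E' q) (window j)).
    move/all_filterP: aE' => ->; apply: ler_wpDl; first exact: mass_ge0.
    apply: le_trans (mass_window _ _) => //.
    by apply: le24; rewrite leq_addr.
  by exfalso; apply: none; exists j => //; exists p, r.
have /andP[j7 jJ] := jr.
exists p, q, r.
move: (pW) (rW); rewrite !mem_window => /and3P[prp jp pj] /and3P[prr jr' rj].
rewrite !expnS expnD in hq qh jp pj jr' rj.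
have q0 := prime_gt0 prq; have r0 := prime_gt0 prr.
split=> //.
- split=> //.
    apply: (window_sub _ pW); apply: leq_trans QJ; rewrite leq_exp2l //; lia.
  apply: (window_sub _ rW); apply: leq_trans QJ; rewrite leq_exp2l //; lia.
- have := leq_mul qh rj; nia.
- have := ltn_mul hq jr'; nia.
Qed.

(** Each step replaces [(d, e)] by [(d p, e q)], with [p < q] not exceptional for [d]
nor for [e].  Both values change sign up to [eps], so they stay opposite.  Since
[q / p >= 1 + eta] the ratio [d / e] shrinks; since [q / p <= 1 + c] and
[d / e > 1 + c] it stays at least [1], which keeps [d] the larger index. *)
Lemma opposite_values_bound (R : realType) (c eta eps mu L : R) (Q Dm : nat)
    (T : nat -> R) :
  (forall E : pred nat, light Q (L + L) E ->
    exists p q, [/\ prime p, prime q, (p <= Q)%N, (q <= Q)%N &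
      [/\ ~~ E p, ~~ E q & (1 + eta) * p%:R <= q%:R <= (1 + c) * p%:R]]) ->
  0 < c -> 0 < eta -> 0 <= eps -> (0 < Q)%N ->
  (forall d s v, (0 < d)%N -> (d <= Dm)%N -> `|s| = 1 -> v <= s * T d ->
     light Q L (fun p => - s * T (d * p)%N < v - eps)) ->
  (forall d e, (0 < e)%N -> (e <= d)%N -> (d <= Dm)%N -> d%:R <= (1 + c) * e%:R :> R ->
     `|T d - T e| <= mu) ->
  forall i d e s v, (0 < e)%N -> (e <= d)%N -> (d * Q ^ i <= Dm)%N ->
    d%:R <= (1 + c) * (1 + eta) ^+ i * e%:R :> R ->
    `|s| = 1 -> v <= s * T d -> v <= - s * T e -> 2 * (v - i%:R * eps) <= mu.
Proof.
move=> pair c0 eta0 eps0 Q0 desc lip; elim=> [|i IH] d e s v e0 ed dD de s1 vd ve.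
  rewrite expr0 mulr1 in de; rewrite expn0 muln1 in dD.
  apply: le_trans (lip _ _ e0 ed dD de); apply: le_trans (_ : s * (T d - T e) <= _).
    rewrite mul0r subr0 mulrBr; lra.
  by apply: le_trans (ler_norm _) _; rewrite normrM s1 mul1r.
have d0 : (0 < d)%N by apply: leq_trans ed.
have dDm : (d <= Dm)%N by apply: leq_trans dD; rewrite leq_pmulr // expn_gt0 Q0.
have [cl|far] := leP (d%:R) ((1 + c) * e%:R : R).
  apply: le_trans (lip _ _ e0 ed dDm cl); apply: le_trans (_ : s * (T d - T e) <= _).
    have : 0 <= i.+1%:R * eps by rewrite mulr_ge0.
    rewrite mulrBr; lra.
  by apply: le_trans (ler_norm _) _; rewrite normrM s1 mul1r.
have eDm : (e <= Dm)%N by exact: leq_trans dDm.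
have s1' : `|- s| = 1 by rewrite normrN.
have [p [q [prp prq pQ qQ [nEp nEq /andP[pq1 pq2]]]]] :=
  pair _ (light_predU (desc _ _ _ d0 dDm s1 vd) (desc _ _ _ e0 eDm s1' ve)).
move: nEp nEq; rewrite /= !negb_or -!leNgt => /andP[vp _] /andP[_ vq].
have p0 := prime_gt0 prp; have q0 := prime_gt0 prq.
have p0R : 0 < p%:R :> R by rewrite ltr0n.
have e0R : 0 < e%:R :> R by rewrite ltr0n.
have q0R : 0 < q%:R :> R by rewrite ltr0n.
have -> : v - i.+1%:R * eps = v - eps - i%:R * eps by rewrite -natr1; ring.
apply: (IH (d * p)%N (e * q)%N (- s)) => //.
- by rewrite muln_gt0 e0.
- rewrite -(ler_nat R) !natrM; apply: le_trans (_ : e%:R * ((1 + c) * p%:R) <= _).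
    by rewrite ler_pM2l.
  by rewrite mulrA [e%:R * _]mulrC ler_pM2r // ltW.
- apply: leq_trans dD; rewrite expnS mulnA leq_mul // leq_mul //.
- rewrite !natrM; rewrite exprS in de.
  apply: le_trans (_ : ((1 + c) * (1 + eta) ^+ i * e%:R) * ((1 + eta) * p%:R) <= _).
    rewrite mulrA ler_pM2r // (le_trans de) // le_eqVlt; apply/orP; left.
    by apply/eqP; ring.
  rewrite -mulrA ler_wpM2l // ?ler_pM2l // mulr_ge0 ?exprn_ge0 //; lra.
Qed.

(** The order of the quantifiers matters: the number [k] of flips depends on [c] only,
so [eps] may be chosen after [k], the weight [L] after [eps], and the range of the
primes and indices after [L]. *)
Lemma flipping_slow_small (R : realType) (c : R) : 0 < c ->
  exists k : nat, forall L : R, exists Q Dm : nat, forall (T : nat -> R) (eps mu : R),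
  0 <= eps ->
  (forall d s v, (0 < d)%N -> (d <= Dm)%N -> `|s| = 1 -> v <= s * T d ->
     light Q L (fun p => - s * T (d * p)%N < v - eps)) ->
  (forall d e, (0 < e)%N -> (e <= d)%N -> (d <= Dm)%N -> d%:R <= (1 + c) * e%:R :> R ->
     `|T d - T e| <= mu) ->
  `|T 1%N| <= mu / 2 + k%:R * eps.
Proof.
move=> c0; have [eta eta0 pairs] := light_complement_pair c0.
have [i Hi] := exists_exp_ge 64 eta0.
(* Two flips lead from 1 to q * r; 64 <= (1 + eta) ^ i bounds the later ones. *)
exists (i.+2) => L; have [Q1 H1] := pairs (L + L); have [Q2 H2] := light_complement_triple L.
pose Q := (maxn Q1 Q2).+1; exists Q, (Q ^ i.+2)%N => T eps mu eps0 desc lip.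
(* The sign s reduces to the case of a nonnegative mean. *)
pose s : R := if 0 <= T 1%N then 1 else -1.
have s1 : `|s| = 1 by rewrite /s; case: ifP; rewrite ?normrN normr1.
have sT : `|T 1%N| = s * T 1%N.
  rewrite /s; case: ifPn => [/ger0_norm->|]; rewrite ?mul1r // -ltNge.
  by move=> /ltr0_norm->; rewrite mulN1r.
set v := `|T 1%N| in sT *.
have Qle a : (a <= i.+2)%N -> (Q ^ a <= Q ^ i.+2)%N by move=> ai; rewrite leq_pexp2l.
have D1 : (1 <= Q ^ i.+2)%N by rewrite expn_gt0.
have s1' : `|- s| = 1 by rewrite normrN.
have QD : (Q <= Q ^ i.+2)%N by rewrite -{1}(expn1 Q) Qle.
have lE := desc 1%N s v isT D1 s1 ltac:(by rewrite sT).
have lE' q : prime q -> (q <= Q)%N -> ~~ (- s * T (1 * q)%N < v - eps) ->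
    light Q L (fun r => - - s * T (q * r)%N < v - eps - eps).
  move=> prq qQ; rewrite -leNgt mul1n => vq.
  by apply: desc => //; [exact: prime_gt0 | exact: leq_trans qQ QD].
have Q2Q : (Q2 <= Q)%N by rewrite /Q; lia.
have [p [q [r [[prp prq prr] [pQ qQ rQ] [nEp nEq nEr] qrp pqr]]]] := H2 Q _ _ Q2Q lE lE'.
move: nEp nEq nEr; rewrite /= !mul1n -!leNgt opprK => vp vq vqr.
have {}vp : v - eps - eps <= - s * T p by lra.
have core := opposite_values_bound (fun E => H1 Q E _) c0 eta0 eps0 _ desc lip.
have {}core := core ltac:(rewrite /Q; lia) isT.
have qr0 : (0 < q * r)%N by rewrite muln_gt0 !prime_gt0.
have p0 := prime_gt0 prp.
have big (a b : nat) : (0 < b)%N -> (a < 64 * b)%N ->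
    a%:R <= (1 + c) * (1 + eta) ^+ i * b%:R :> R.
  move=> b0 ab; have b0R : 0 < b%:R :> R by rewrite ltr0n.
  apply: le_trans (_ : (64 * b)%:R <= _); first by rewrite ler_nat ltnW.
  rewrite natrM ler_pM2r //; apply: le_trans Hi _; rewrite ler_peMl ?exprn_ge0 //; lra.
suff : 2 * (v - eps - eps - i%:R * eps) <= mu by rewrite -(addn2 i) natrD mulrDl; lra.
have [ple|qrle] := leqP p (q * r).
  apply: (core i (q * r)%N p s) => //; last exact: big.
  by rewrite (expnD Q 2 i) leq_mul // leq_mul.
apply: (core i p (q * r)%N (- s)) => //; [exact: ltnW | | exact: big | by rewrite opprK].
by rewrite expnS leq_mul // expnS leq_pmull.
Qed.

(** * Averages along multiples of primes *)

Lemma sum_multiples (V : zmodType) (a : nat -> V) (p x : nat) : (0 < p)%N ->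
  \sum_(1 <= n < x.+1 | (p %| n)%N) a n = \sum_(1 <= m < (x %/ p).+1) a (p * m)%N.
Proof.
move=> p0; elim: x => [|x IH]; first by rewrite div0n !big_geq.
rewrite big_mkcond big_nat_recr //= -big_mkcond IH divnS //.
case: ifP => [px|_]; last by rewrite addr0 add0n.
rewrite add1n [RHS]big_nat_recr //=; congr (_ + a _).
move: px => /dvdnP[q qE]; have := divnS x p0.
by rewrite qE dvdn_mull // mulnK // add1n => <-; rewrite mulnC.
Qed.

Lemma sum_dvdn (R : realType) (d x : nat) :
  \sum_(1 <= n < x.+1) (d %| n)%:R = (x %/ d)%:R :> R.
Proof. by rewrite divn_count_dvd natr_sum. Qed.

Lemma divn_le_ratio (R : realType) (x d : nat) : (0 < d)%N ->
  (x %/ d)%:R <= x%:R / d%:R :> R.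
Proof. by move=> d0; rewrite ler_pdivlMr ?ltr0n // -natrM ler_nat leq_trunc_div. Qed.

Lemma divn_ge_ratio (R : realType) (x d : nat) : (0 < d)%N ->
  x%:R / d%:R - 1 <= (x %/ d)%:R :> R.
Proof.
move=> d0; rewrite lerBlDr ler_pdivrMr ?ltr0n // natr1 -natrM ler_nat.
by rewrite ltnW // -ltn_divLR // ltnS.
Qed.

(** The second moment of the number of prime divisors in [B] of [n <= x], about [L].
The term [2 L #|B|] accounts for the integer parts in the first moment. *)
Lemma turan_kubilius (R : realType) (B : seq nat) (x : nat) (L := mass R B) :
  uniq B -> all prime B ->
  \sum_(1 <= n < x.+1) (L - \sum_(p <- B) (p %| n)%:R) ^+ 2
    <= x%:R * L + 2 * L * (size B)%:R.
Proof.
move=> uB prB.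
pose w (n : nat) : R := \sum_(p <- B) (p %| n)%:R.
have L0 : 0 <= L by exact: mass_ge0.
have Bp p : p \in B -> (0 < p)%N by move=> /(allP prB)/prime_gt0.
have first_moment : x%:R * L - (size B)%:R <= \sum_(1 <= n < x.+1) w n.
  rewrite exchange_big /= -sum1_size natr_sum /L /mass mulr_sumr -sumrB.
  rewrite big_seq [leRHS]big_seq; apply: ler_sum => p /Bp p0.
  by rewrite sum_dvdn divn_ge_ratio.
have second_moment : \sum_(1 <= n < x.+1) w n ^+ 2 <= x%:R * L ^+ 2 + x%:R * L.
  have -> : \sum_(1 <= n < x.+1) w n ^+ 2 =
      \sum_(p <- B) \sum_(q <- B) \sum_(1 <= n < x.+1) (p %| n)%:R * (q %| n)%:R.
    under eq_bigr do rewrite expr2 /w big_distrlr.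
    by rewrite exchange_big /=; apply: eq_bigr => p _; rewrite exchange_big.
  (* The square of L accounts for the pairs p != q, and the term x L for p = q. *)
  have -> : x%:R * L ^+ 2 + x%:R * L =
      \sum_(p <- B) (\sum_(q <- B) x%:R / (p%:R * q%:R) + x%:R / p%:R).
    rewrite big_split /=; congr (_ + _); last by rewrite /L /mass mulr_sumr.
    rewrite expr2 /L /mass big_distrlr mulr_sumr; apply: eq_bigr => p _.
    by rewrite mulr_sumr; apply: eq_bigr => q _; rewrite invfM.
  rewrite big_seq [leRHS]big_seq; apply: ler_sum => p pB; have p0 := Bp _ pB.
  rewrite (bigD1_seq p) //= [leLHS]addrC; apply: lerD; last first.
    apply: le_trans (divn_le_ratio _ _ p0); rewrite -sum_dvdn.
    by apply: ler_sum => n _; case: (p %| n)%N; rewrite ?mulr1 ?mulr0.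
  rewrite big_mkcond /= big_seq [leRHS]big_seq; apply: ler_sum => q qB; have q0 := Bp _ qB.
  case: ifP => [qp|_]; last by rewrite divr_ge0 ?mulr_ge0.
  apply: le_trans (_ : (x %/ (p * q))%:R <= _); last first.
    by rewrite -natrM divn_le_ratio // muln_gt0 p0.
  rewrite -sum_dvdn; apply: ler_sum => n _; rewrite -natrM mulnb Gauss_dvd //.
  by rewrite prime_coprime ?(allP prB) // dvdn_prime2 ?(allP prB) // eq_sym qp.
have -> : \sum_(1 <= n < x.+1) (L - w n) ^+ 2 =
    x%:R * L ^+ 2 - 2 * L * (\sum_(1 <= n < x.+1) w n) + \sum_(1 <= n < x.+1) w n ^+ 2.
  under eq_bigr do rewrite sqrrB.
  rewrite big_split sumrB /= sumr_const_nat subSS subn0 mulr_natl; congr (_ - _ + _).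
  by rewrite mulr_sumr; apply: eq_bigr => n _; ring.
have := ler_wpM2l L0 first_moment; lra.
Qed.

Definition partial_sum (R : realType) (a : nat -> R) (x : nat) : R :=
  \sum_(1 <= n < x.+1) a n.

Lemma weighted_am_gm (R : realType) (t u : R) : 0 < t -> u <= 2^-1 * (t + u ^+ 2 / t).
Proof.
move=> t0; rewrite ler_pdivlMl // -(ler_pM2r t0) [leRHS]mulrDl divfK ?gt_eqF //.
have := sqr_ge0 (u - t); nra.
Qed.

(** The sum of [a n] times the number of prime divisors of [n] in [B] is, by counting
multiples of each [p], the sum of [a (p m)] over [p] in [B] and [m <= x / p], where
[a (p m)] is about [- a m]; by [turan_kubilius] it is also about [L] times the sum
of [a n].  The parameter [t] replaces a Cauchy-Schwarz inequality. *)
Lemma prime_dilation_average (R : realType) (a : nat -> R) (C delta t : R)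
    (B : seq nat) (x : nat) (L := mass R B) :
  0 <= C -> (forall n, `|a n| <= C) -> uniq B -> all prime B -> 0 < t ->
  (forall p n, prime p -> (0 < n)%N -> `|a (p * n)%N + a n| <= delta) ->
  `|L * partial_sum a x + \sum_(p <- B) partial_sum a (x %/ p)| <=
     C * (x%:R * t + (x%:R * L + 2 * L * (size B)%:R) / t) / 2 + delta * x%:R * L.
Proof.
move=> C0 aC uB prB t0 flip.
pose w (n : nat) : R := \sum_(p <- B) (p %| n)%:R.
have Bp p : p \in B -> (0 < p)%N by move=> /(allP prB)/prime_gt0.
have dw : \sum_(1 <= n < x.+1) a n * w n =
    \sum_(p <- B) \sum_(1 <= m < (x %/ p).+1) a (p * m)%N.
  under eq_bigr do rewrite mulr_sumr.
  rewrite exchange_big /= big_seq [RHS]big_seq; apply: eq_bigr => p /Bp p0.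
  rewrite -sum_multiples // [RHS]big_mkcond; apply: eq_bigr => n _.
  by case: (p %| n)%N; rewrite ?mulr1 ?mulr0.
have -> : L * partial_sum a x + \sum_(p <- B) partial_sum a (x %/ p) =
   \sum_(1 <= n < x.+1) a n * (L - w n) +
   \sum_(p <- B) \sum_(1 <= m < (x %/ p).+1) (a (p * m)%N + a m).
  under [X in _ = X + _]eq_bigr do rewrite mulrBr.
  under [X in _ = _ + X]eq_bigr do rewrite big_split /=.
  rewrite sumrB big_split /= dw addrA subrK; congr (_ + _).
  by rewrite mulr_sumr; apply: eq_bigr => n _; rewrite mulrC.
apply: le_trans (ler_normD _ _) _; apply: lerD.
  apply: le_trans (ler_norm_sum _ _ _) _.
  apply: le_trans (_ : \sum_(1 <= n < x.+1) C / 2 * (t + (L - w n) ^+ 2 / t) <= _).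
    apply: ler_sum => n _; rewrite normrM; apply: le_trans (_ : C * `|L - w n| <= _).
      by rewrite ler_wpM2r.
    rewrite -mulrA ler_wpM2l // -(real_normK (num_real (L - w n))).
    exact: weighted_am_gm.
  rewrite -mulr_sumr [leRHS]mulrAC ler_wpM2l ?divr_ge0 // big_split /= sumr_const_nat subSS subn0.
  rewrite -[t *+ x]mulr_natl lerD2l -mulr_suml ler_pM2r ?invr_gt0 //.
  exact: turan_kubilius.
apply: le_trans (ler_norm_sum _ _ _) _.
rewrite -mulrA /L /mass !mulr_sumr big_seq [leRHS]big_seq; apply: ler_sum => p pB.
have p0 := Bp _ pB; have prp := allP prB _ pB.
apply: le_trans (ler_norm_sum _ _ _) _.
apply: le_trans (_ : \sum_(1 <= m < (x %/ p).+1) delta <= _).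
  by rewrite !big_nat; apply: ler_sum => m /andP[m0 _]; exact: flip.
rewrite sumr_const_nat subSS subn0 -[_ *+ (x %/ p)]mulr_natr ler_wpM2l ?divn_le_ratio //.
by apply: le_trans (flip p 1%N prp isT).
Qed.

(** The factor [d / N] instead of [1 / (N %/ d)] makes
[(d / N) * partial_sum a ((N %/ d) %/ p) = dilated_mean a N (d * p) / p] exact. *)
Definition dilated_mean (R : realType) (a : nat -> R) (N d : nat) : R :=
  d%:R / N%:R * partial_sum a (N %/ d).

Lemma partial_sumB_le (R : realType) (a : nat -> R) (C : R) (x y : nat) :
  (forall n, `|a n| <= C) -> (x <= y)%N ->
  `|partial_sum a y - partial_sum a x| <= C * (y%:R - x%:R).
Proof.
move=> aC xy; rewrite /partial_sum (@big_cat_nat _ _ _ x.+1) //= addrAC subrr add0r.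
apply: le_trans (ler_norm_sum _ _ _) _.
apply: le_trans (_ : \sum_(x.+1 <= i < y.+1) C <= _); first exact: ler_sum.
by rewrite sumr_const_nat subSS -[C *+ _]mulr_natr natrB.
Qed.

Lemma partial_sum_le (R : realType) (a : nat -> R) (C : R) (x : nat) :
  (forall n, `|a n| <= C) -> `|partial_sum a x| <= C * x%:R.
Proof.
by move=> aC; have := partial_sumB_le aC (leq0n x); rewrite {2}/partial_sum big_geq // !subr0.
Qed.

Lemma dilated_mean_slowly_varying (R : realType) (a : nat -> R) (C c : R) (N d e : nat) :
  0 <= C -> (forall n, `|a n| <= C) -> (0 < N)%N -> (0 < e)%N -> (e <= d)%N ->
  d%:R <= (1 + c) * e%:R :> R -> d%:R <= c * N%:R ->
  `|dilated_mean a N d - dilated_mean a N e| <= 3 * C * c.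
Proof.
move=> C0 aC N0 e0 ed dce dN.
have d0 := leq_trans e0 ed.
have N0R : 0 < N%:R :> R by rewrite ltr0n.
have d0R : 0 < d%:R :> R by rewrite ltr0n.
have e0R : 0 < e%:R :> R by rewrite ltr0n.
have edR : e%:R <= d%:R :> R by rewrite ler_nat.
set x := (N %/ d)%N; set y := (N %/ e)%N.
have xy : (x <= y)%N by rewrite leq_div2l.
have xN : x%:R * d%:R <= N%:R :> R by rewrite -natrM ler_nat leq_trunc_div.
have yN : y%:R * e%:R <= N%:R :> R by rewrite -natrM ler_nat leq_trunc_div.
have Nx : N%:R <= (x%:R + 1) * d%:R :> R.
  by rewrite natr1 -natrM ler_nat ltnW // -ltn_divLR.
have -> : dilated_mean a N d - dilated_mean a N e =
   ((d%:R - e%:R) * partial_sum a x - e%:R * (partial_sum a y - partial_sum a x)) / N%:R.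
  by rewrite /dilated_mean -/x -/y; field; rewrite gt_eqF.
rewrite normrM normfV (gtr0_norm N0R) ler_pdivrMr //.
apply: le_trans (ler_normB _ _) _; rewrite !normrM (gtr0_norm e0R) ger0_norm ?subr_ge0 //.
have x0 : 0 <= x%:R :> R by [].
have h1 : (d%:R - e%:R) * `|partial_sum a x| <= (d%:R - e%:R) * (C * x%:R).
  by rewrite ler_wpM2l ?subr_ge0 // partial_sum_le.
have h2 : e%:R * `|partial_sum a y - partial_sum a x| <= e%:R * (C * (y%:R - x%:R)).
  by rewrite ler_wpM2l ?partial_sumB_le // ltW.
apply: le_trans (lerD h1 h2) _.
have c0 : 0 <= c by rewrite -(pmulr_lge0 _ N0R) (le_trans _ dN).
have dex : (d%:R - e%:R) * x%:R <= c * N%:R.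
  apply: le_trans (_ : c * e%:R * x%:R <= _); first by rewrite ler_wpM2r //; lra.
  rewrite -mulrA ler_wpM2l // mulrC (le_trans _ xN) // ler_wpM2l //.
have eyx : e%:R * (y%:R - x%:R) <= 2 * c * N%:R.
  rewrite mulrBr [e%:R * y%:R]mulrC; nra.
have -> : (d%:R - e%:R) * (C * x%:R) + e%:R * (C * (y%:R - x%:R)) =
   C * ((d%:R - e%:R) * x%:R + e%:R * (y%:R - x%:R)) by ring.
have -> : 3 * C * c * N%:R = C * (c * N%:R + 2 * c * N%:R) by ring.
by rewrite ler_wpM2l // lerD.
Qed.

Lemma size_le_of_bounded (B : seq nat) (Q : nat) :
  uniq B -> all prime B -> {in B, forall p, (p <= Q)%N} -> (size B <= Q)%N.
Proof.
move=> uB prB BQ; rewrite -[leqRHS](size_iota 1); apply: uniq_leq_size => // p pB.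
by rewrite mem_iota prime_gt0 ?(allP prB) //= add1n ltnS BQ.
Qed.

(** [prime_dilation_average] is applied to a set [B] made of exceptional primes only.
If [L] is its reciprocal sum, the defect [eps * L] forced by [B] competes with an
error of order [sqrt L], hence [L] is bounded.  The choice [t = eps L / (2 C)]
makes the term [C t / 2] equal to [eps L / 4]. *)
Lemma light_flip_failures (R : realType) (a : nat -> R) (C eps s v : R) (N d Q : nat) :
  0 < C -> (forall n, `|a n| <= C) -> 0 < eps -> (0 < d)%N -> (Q * d <= N)%N -> (0 < N)%N ->
  (forall p n, prime p -> (0 < n)%N -> `|a (p * n)%N + a n| <= eps / 4) ->
  `|s| = 1 -> v <= s * dilated_mean a N d ->
  light Q (6 * C ^+ 2 / eps ^+ 2) (fun p => - s * dilated_mean a N (d * p)%N < v - eps).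
Proof.
move=> C0 aC eps0 d0 QdN N0 flip s1 vd B uB prB BE.
set L := mass R B; have [L0|L0] := leP L 0.
  by apply: le_trans L0 _; rewrite divr_ge0 ?mulr_ge0 ?exprn_ge0 // ltW.
have N0R : 0 < N%:R :> R by rewrite ltr0n.
have d0R : 0 < d%:R :> R by rewrite ltr0n.
set x := (N %/ d)%N.
have xN : d%:R * x%:R <= N%:R :> R by rewrite -natrM ler_nat mulnC leq_trunc_div.
have bN : (size B)%:R * d%:R <= N%:R :> R.
  rewrite -natrM ler_nat (leq_trans _ QdN) // leq_mul2r (size_le_of_bounded uB prB) ?orbT //.
  by move=> p /BE /andP[].
pose t := eps * L / (2 * C).
have t0 : 0 < t by rewrite divr_gt0 ?mulr_gt0.
have := prime_dilation_average x (ltW C0) aC uB prB t0 flip; rewrite -/L.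
set A := _ + _ => HA.
have lower : eps * L <= s * (d%:R / N%:R * A).
  have -> : s * (d%:R / N%:R * A) = L * (s * dilated_mean a N d) +
      \sum_(p <- B) (s * dilated_mean a N (d * p)%N) / p%:R.
    rewrite /A /dilated_mean -/x !mulrDr; congr (_ + _); first by ring.
    rewrite !mulr_sumr big_seq [RHS]big_seq; apply: eq_bigr => p /(allP prB) /prime_gt0 p0.
    rewrite -divnMA natrM; field; rewrite !gt_eqF ?ltr0n //.
  have h : \sum_(p <- B) (eps - v) / p%:R <=
      \sum_(p <- B) (s * dilated_mean a N (d * p)%N) / p%:R.
    rewrite big_seq [leRHS]big_seq; apply: ler_sum => p /BE /andP[_ bad].
    by rewrite ler_wpM2r ?invr_ge0 //; rewrite mulNr in bad; lra.
  rewrite -mulr_sumr -/(mass R B) -/L in h.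
  have := ler_wpM2l (ltW L0) vd; lra.
have upper : s * (d%:R / N%:R * A) <= d%:R / N%:R * `|A|.
  apply: le_trans (ler_norm _) _; by rewrite !normrM s1 mul1r normfV !normr_nat.
have {HA}bound : d%:R / N%:R * `|A| <= C * (t + 3 * L / t) / 2 + eps / 4 * L.
  rewrite mulrAC ler_pdivrMr //; apply: le_trans (ler_wpM2l (ltW d0R) HA) _.
  have -> : d%:R * (C * (x%:R * t + (x%:R * L + 2 * L * (size B)%:R) / t) / 2
      + eps / 4 * x%:R * L)
    = C * (d%:R * x%:R * t + (d%:R * x%:R * L + 2 * L * ((size B)%:R * d%:R)) / t) / 2
      + eps / 4 * (d%:R * x%:R) * L by ring.
  have -> : (C * (t + 3 * L / t) / 2 + eps / 4 * L) * N%:R =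
     C * (N%:R * t + (N%:R * L + 2 * L * N%:R) / t) / 2 + eps / 4 * N%:R * L by ring.
  apply: lerD; last by rewrite ler_wpM2r ?(ltW L0) // ler_wpM2l // divr_ge0 // ltW.
  rewrite ler_wpM2r // ler_wpM2l ?(ltW C0) //; apply: lerD; first by rewrite ler_wpM2r // ltW.
  rewrite ler_wpM2r ?invr_ge0 ?(ltW t0) //; apply: lerD; first by rewrite ler_wpM2r // ltW.
  by rewrite ler_wpM2l // mulr_ge0 // ltW.
have := le_trans lower (le_trans upper bound).
have -> : C * (t + 3 * L / t) / 2 + eps / 4 * L = eps * L / 2 + 3 * C ^+ 2 / eps.
  by rewrite /t; field; rewrite !gt_eqF.
rewrite ler_pdivlMr ?exprn_gt0 // => H.
have : eps * L / 2 * eps <= 3 * C ^+ 2 by rewrite -ler_pdivlMr //; lra.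
lra.
Qed.

(** The constants are fixed in the order [c], [k], [eps], [Q] and [D], [N]: the choice
of [c] makes the slow-variation bound equal to [tau], of which half is used, and
[eps] makes the [k] flips cost at most [tau / 2]. *)
Theorem sign_flipping_mean (R : realType) (a : nat -> nat -> R) (C : R) :
  (forall N n, `|a N n| <= C) ->
  (forall delta, 0 < delta -> exists N0, forall N, (N0 <= N)%N ->
     forall p n, prime p -> (0 < n)%N -> `|a N (p * n)%N + a N n| <= delta) ->
  forall tau, 0 < tau -> exists N0, forall N, (N0 <= N)%N ->
    `|N%:R^-1 * \sum_(1 <= n < N.+1) a N n| <= tau.
Proof.
move=> aC0 flip tau tau0.
pose C' := `|C| + 1.
have C'0 : 0 < C' by rewrite ltr_wpDl.
have aC N n : `|a N n| <= C'.
  apply: le_trans (aC0 N n) _; apply: le_trans (ler_norm _) _.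
  by rewrite lerDl.
pose c := tau / (3 * C').
have c0 : 0 < c by rewrite divr_gt0 ?mulr_gt0.
have [k Hk] := flipping_slow_small c0.
pose eps := tau / (2 * k.+1%:R).
have eps0 : 0 < eps by rewrite divr_gt0 ?mulr_gt0.
have [Q [D HD]] := Hk (6 * C' ^+ 2 / eps ^+ 2).
have eps4 : 0 < eps / 4 by rewrite divr_gt0.
have [N1 HN1] := flip _ eps4.
have [N2 HN2] := exists_nat_ge (D%:R / c).
exists (maxn (maxn N1 N2) (Q * D).+1) => N; rewrite !geq_max => /andP[/andP[NN1 NN2] NQD].
have N0 : (0 < N)%N by exact: leq_trans NQD.
have -> : N%:R^-1 * \sum_(1 <= n < N.+1) a N n = dilated_mean (a N) N 1.
  by rewrite /dilated_mean divn1 mul1r.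
apply: le_trans (HD _ eps (3 * C' * c) (ltW eps0) _ _) _.
- move=> d s v d0 dD s1 vd; apply: light_flip_failures => //; last exact: HN1.
  by apply: leq_trans (ltnW NQD); rewrite leq_mul.
- move=> d e e0 ed dD dce; apply: dilated_mean_slowly_varying => //; first exact: ltW.
  apply: (@le_trans _ _ D%:R); first by rewrite ler_nat.
  rewrite mulrC -ler_pdivrMr // (le_trans HN2) // ler_nat //.
have -> : 3 * C' * c / 2 = tau / 2 by rewrite /c; field; rewrite gt_eqF.
suff : k%:R * eps <= tau / 2 by lra.
have -> : k%:R * eps = tau / 2 * (k%:R / k.+1%:R).
  by rewrite /eps; field; rewrite gt_eqF.
by rewrite ler_piMr ?divr_ge0 ?ler_pdivrMr ?mul1r ?ler_nat // ltW.
Qed.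

(** * Liouville sums weighted by a function of [bigomega] *)

(** A common range of summation for [n] and [p * n] makes the additivity of [logn]
applicable term by term. *)
Lemma bigomega_sum (m K : nat) : (m < K)%N ->
  bigomega m = (\sum_(0 <= q < K) logn q m)%N.
Proof.
move=> mK; rewrite [RHS](bigID (mem (primes m))) /= [X in (_ + X)%N]big1 ?addn0; last first.
  by move=> q; rewrite -logn_gt0 lt0n negbK => /eqP.
rewrite -big_filter; apply: perm_big; apply: uniq_perm.
- exact: primes_uniq.
- by rewrite filter_uniq // iota_uniq.
move=> q; rewrite mem_filter mem_index_iota /=.
case: (boolP (q \in primes m)) => //; rewrite mem_primes => /and3P[_ m0 /(dvdn_leq m0) qm].
by rewrite (leq_ltn_trans qm mK).
Qed.

Lemma bigomega_primeM (p n : nat) : prime p -> (0 < n)%N ->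
  bigomega (p * n) = (bigomega n).+1.
Proof.
move=> pr n0; have p0 := prime_gt0 pr.
have nK : (n < (p * n).+1)%N by rewrite ltnS leq_pmull.
have pK : (p < (p * n).+1)%N by rewrite ltnS leq_pmulr.
rewrite (bigomega_sum (ltnSn _)) (bigomega_sum nK) -[RHS]add1n.
under eq_bigr do rewrite lognM //.
rewrite big_split /=; congr (_ + _)%N.
under eq_bigr do rewrite logn_prime //.
rewrite (bigD1_seq p) ?iota_uniq ?mem_index_iota //= eqxx big1 // => q /negbTE.
by rewrite eq_sym => ->.
Qed.

Lemma loglog_unbounded (R : realType) (A : R) :
  exists N0, forall N, (N0 <= N)%N -> A <= loglog R N.
Proof.
have [N0 HN0] := exists_nat_ge (expR (expR A)).
exists N0 => N NN0.
have HN : expR (expR A) <= N%:R by rewrite (le_trans HN0) // ler_nat.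
have lnN : expR A <= ln N%:R.
  rewrite -[leLHS]expRK ler_ln ?posrE ?expR_gt0 //.
  by rewrite (lt_le_trans _ HN) ?expR_gt0.
rewrite /loglog -[leLHS]expRK ler_ln ?posrE ?expR_gt0 //.
by rewrite (lt_le_trans _ lnN) ?expR_gt0.
Qed.

Lemma support_vanish (R : realType) (F : R -> R) (x : R) :
  ~ closure [set x | F x != 0] x -> F x = 0.
Proof.
move=> nx; apply/eqP/negPn/negP => Fx; apply: nx; exact: subset_closure.
Qed.

Lemma compactly_supported_bounded (R : realType) (F : R -> R) :
  continuous F -> compactly_supported F -> exists C, forall x, `|F x| <= C.
Proof.
move=> Fc Fs; have : compact (F @` closure [set x | F x != 0]).
  by apply: continuous_compact => //; exact: continuous_subspaceT.
move=> /compact_bounded [M [_ HM]].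
exists (Num.max 0 (M + 1)) => x.
have [Kx|/support_vanish->] := pselect (closure [set x | F x != 0] x).
  by rewrite le_max (HM (M + 1)) ?ltrDl ?orbT //; exists x.
by rewrite normr0 le_max lexx.
Qed.

(** Compactness of the support gives a [delta] that works when [x] is in it.  When only
[x + h] is in the support, exchange the two points. *)
Lemma compactly_supported_unif_continuous (R : realType) (F : R -> R) (eps : R) :
  continuous F -> compactly_supported F -> 0 < eps ->
  exists2 delta, 0 < delta & forall x h, `|h| < delta -> `|F (x + h) - F x| <= eps.
Proof.
move=> Fc Fs eps0; set K := closure [set x | F x != 0].
have /compact_near_coveringP cov : compact K by [].
have : \forall h \near (0 : R), K `<=` (fun x => `|F (x + h) - F x| <= eps).
  apply: (cov R (nbhs (0 : R)) (fun h x => `|F (x + h) - F x| <= eps)) => x Kx.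
  have cvF : (F (z.1 + z.2) - F z.1) @[z --> (x, 0 : R)] --> F (x + 0) - F x.
    apply: cvgB.
      apply: (@cvg_comp _ _ _ (fun z : R * R => z.1 + z.2) F); last exact: Fc.
      by apply: cvgD; [exact: cvg_fst | exact: cvg_snd].
    by apply: (@cvg_comp _ _ _ (fun z : R * R => z.1) F); [exact: cvg_fst | exact: Fc].
  rewrite addr0 subrr in cvF.
  by move: cvF => /cvgr0Pnorm_le /(_ _ eps0).
move=> /nbhs_ballP[delta /= delta0 Hd].
have H h : `|h| < delta -> K `<=` (fun x => `|F (x + h) - F x| <= eps).
  by move=> hd; apply: Hd; rewrite /ball /= sub0r normrN.
exists delta => // x h hd.
have [Kx|nKx] := pselect (K x); first exact: (H h hd x Kx).
have [Kxh|nKxh] := pselect (K (x + h)); last first.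
  by rewrite (support_vanish nKx) (support_vanish nKxh) subrr normr0 ltW.
have hd' : `|- h| < delta by rewrite normrN.
by have := H _ hd' _ Kxh; rewrite addrK distrC.
Qed.

Theorem corollary1p4 (R : realType) (F : R -> R)
    (F_cont : continuous F) (F_supp : compactly_supported F) :
  N%:R^-1 * (\sum_(1 <= n < N.+1)
      F (((bigomega n)%:R - loglog R N) / Num.sqrt (loglog R N))
      * (liouville n)%:~R) @[N --> \oo] --> (0 : R).
Proof.
have [C FC] := compactly_supported_bounded F_cont F_supp.
have sign_norm n : `|(liouville n)%:~R : R| = 1.
  by rewrite /liouville rmorphXn /= normrX rmorphN1 normrN1 expr1n.
apply/cvgr0Pnorm_le => tau tau0.
have [||N0 HN0] := @sign_flipping_mean R (fun N n =>
    F (((bigomega n)%:R - loglog R N) / Num.sqrt (loglog R N))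
    * (liouville n)%:~R) C _ _ tau tau0.
- by move=> N n; rewrite normrM sign_norm mulr1.
- move=> eps eps0.
  have [delta delta0 Fd] := compactly_supported_unif_continuous F_cont F_supp eps0.
  have [N0 HN0] := loglog_unbounded ((2 / delta) ^+ 2).
  exists N0 => N /HN0 Nl p n pr n0.
  have shift : (Num.sqrt (loglog R N))^-1 < delta.
    have sl : 2 / delta <= Num.sqrt (loglog R N).
      have e0 : 0 <= 2 / delta by rewrite divr_ge0 // ltW.
      by rewrite -(ger0_norm e0) -sqrtr_sqr ler_wsqrtr.
    have s0 : 0 < Num.sqrt (loglog R N) by apply: lt_le_trans sl; rewrite divr_gt0.
    rewrite invf_plt ?posrE //; apply: lt_le_trans sl.
    by rewrite ltr_pdivlMr // mulVf ?gt_eqF // ltr1n.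
  have -> : (liouville (p * n))%:~R = - (liouville n)%:~R :> R.
    by rewrite /liouville bigomega_primeM // exprS mulN1r rmorphN.
  rewrite mulrN addrC -mulrBl normrM sign_norm mulr1 distrC bigomega_primeM // -natr1.
  rewrite addrAC mulrDl mul1r; apply: Fd.
  by rewrite normfV ger0_norm ?sqrtr_ge0.
by exists N0 => // N /= /HN0.
Qed.
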